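(* Let $d^*\in\{1,\dots,S\}$ be a comparison depth maximizing $h_3(d)$ over $d\in\{1,\dots,S\}$. Then the uniform design $\bar\xi_{d^*}$ on $\mathcal{X}^{(S)}_{d^*}$ is $D$-optimal for the vector of second-order interaction effects $(\boldsymbol\beta_{k\ell m})_{k<\ell<m}$, i.e. it maximizes the determinant of the information matrix for this subvector of parameters (the Schur complement of the main-effect and first-order-interaction block in $\mathbf{M}(\xi)$) over all approximate designs $\xi$ on $\mathcal{X}^{(S)}$.
   Context: Fix integers $v\ge 2$, $K\ge 3$ and $S$ with $3\le S\le K$. Let $\mathbf{e}_i$ denote the $i$th unit vector of $\mathbb{R}^{v-1}$ and $\mathbf{1}_{v-1}$ the all-ones vector. Define $\mathbf{f}_1:\{0,1,\dots,v\}\to\mathbb{R}^{v-1}$ by $\mathbf{f}_1(i)=\mathbf{e}_i$ for $1\le i\le v-1$, $\mathbf{f}_1(v)=-\mathbf{1}_{v-1}$, $\mathbf{f}_1(0)=\mathbf{0}$. Consider the linear paired comparison model $Y(\mathbf{i},\mathbf{j})=(\mathbf{f}(\mathbf{i})-\mathbf{f}(\mathbf{j}))^\top\boldsymbol\beta+\varepsilon$ with uncorrelated homoscedastic zero-mean errors, where $\mathbf{f}(\mathbf{i})$ stacks $\mathbf{f}_1(i_k)$ ($k=1,\dots,K$), then $\mathbf{f}_1(i_k)\otimes\mathbf{f}_1(i_\ell)$ ($k<\ell$), then $\mathbf{f}_1(i_k)\otimes\mathbf{f}_1(i_\ell)\otimes\mathbf{f}_1(i_m)$ ($k<\ell<m$),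 and correspondingly $\boldsymbol\beta=((\boldsymbol\beta_k)_k,(\boldsymbol\beta_{k\ell})_{k<\ell},(\boldsymbol\beta_{k\ell m})_{k<\ell<m})$ (main effects, first-order and second-order interactions). The design region $\mathcal{X}^{(S)}$ is the set of ordered pairs $(\mathbf{i},\mathbf{j})$ in $\{0,\dots,v\}^K$ for which there is a set $A$ of exactly $S$ attributes with $i_k,j_k\in\{1,\dots,v\}$ for $k\in A$ and $i_k=j_k=0$ for $k\notin A$; $\mathcal{X}^{(S)}_d$ is the subset with $i_k\ne j_k$ for exactly $d$ indices $k$. An approximate design is a finitely supported probability measure $\xi$ on $\mathcal{X}^{(S)}$ with information matrix $\mathbf{M}(\xi)=\sum\xi(\mathbf{i},\mathbf{j})(\mathbf{f}(\mathbf{i})-\mathbf{f}(\mathbf{j}))(\mathbf{f}(\mathbf{i})-\mathbf{f}(\mathbf{j}))^\top$; $\bar\xi_d$ is the uniform design on $\mathcal{X}^{(S)}_d$. The function is $h_3(d)=\frac{d\lambda(d)}{4v^2K(K-1)(K-2)}$ with $\lambda(d)=3S^2+3S^2v^2-6S^2v-3Sdv^2+3Sdv-6Sv^2+15Sv-9S+d^2v^2+3dv^2-6dv+2v^2-6v+6$. *)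

(* Defs.v *)
From HB Require Import structures.
From mathcomp Require Import all_boot all_order all_algebra.
Set Implicit Arguments. Unset Strict Implicit. Unset Printing Implicit Defensive.
Import Order.TTheory GRing.Theory Num.Theory.
Local Open Scope ring_scope.

Section PairedComparison.
Variables (R : realFieldType) (v K : nat).

Definition attr := {ffun 'I_K -> 'I_v.+1}.
Definition point := (attr * attr)%type.

Definition inX (S : nat) (x : point) : bool :=
  [exists A : {set 'I_K}, (#|A| == S) &&
     [forall k : 'I_K, if k \in A
        then (x.1 k != ord0) && (x.2 k != ord0)
        else (x.1 k == ord0) && (x.2 k == ord0)]].

Definition inXd (S d : nat) (x : point) : bool :=
  inX S x && (#|[set k | x.1 k != x.2 k]| == d).

(* coordinate a (0-based, a < v-1) of f_1(c):
   f_1(i) = e_i (1 <= i <= v-1), f_1(v) = -1, f_1(0) = 0 *)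
Definition f1c (c : 'I_v.+1) (a : 'I_v.-1) : R :=
  if (c == 0 :> nat) then 0
  else if (c == v :> nat) then -1
  else ((a.+1 == c)%N)%:R.

Notation I1 := ('I_K * 'I_v.-1)%type.
Notation I2 := {t : ('I_K * 'I_K) * ('I_v.-1 * 'I_v.-1) | (t.1.1 < t.1.2)%N}.
Notation I3 := {t : ('I_K * 'I_K * 'I_K) * ('I_v.-1 * 'I_v.-1 * 'I_v.-1)
                  | (t.1.1.1 < t.1.1.2)%N && (t.1.1.2 < t.1.2)%N}.

(* components of f(i); the Kronecker product entries are products of coordinates *)
Definition fm (i : attr) (t : I1) : R := f1c (i t.1) t.2.
Definition f2 (i : attr) (t : I2) : R :=
  let: ((k, l), (a, b)) := val t in f1c (i k) a * f1c (i l) b.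
Definition f3 (i : attr) (t : I3) : R :=
  let: ((k, l, m), (a, b, c)) := val t in f1c (i k) a * f1c (i l) b * f1c (i m) c.

Notation I12 := (I1 + I2)%type.
Definition f12 (i : attr) (t : I12) : R :=
  match t with inl t => fm i t | inr t => f2 i t end.

(* block of the information matrix M(xi) = sum xi(x) (f(i)-f(j))(f(i)-f(j))^T *)
Definition Mblk (A B : finType) (FA : attr -> A -> R) (FB : attr -> B -> R)
  (xi : point -> R) : 'M[R]_(#|{: A}|, #|{: B}|) :=
  \matrix_(r < #|{: A}|, c < #|{: B}|)
    \sum_(x : point) xi x * (FA x.1 (enum_val r) - FA x.2 (enum_val r))
                          * (FB x.1 (enum_val c) - FB x.2 (enum_val c)).

(* information matrix for the second-order interactions: Schur complement
   M33 - M31 M11^- M13 (pinvmx is a generalized inverse) *)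
Definition info3 (xi : point -> R) : 'M[R]_#|{: I3}| :=
  Mblk f3 f3 xi - Mblk f3 f12 xi *m pinvmx (Mblk f12 f12 xi) *m Mblk f12 f3 xi.

(* approximate designs on X^(S) (finite region, so finitely supported) *)
Definition is_design (S : nat) (xi : point -> R) : Prop :=
  (forall x, 0 <= xi x) /\ (forall x, xi x != 0 -> inX S x) /\
  \sum_(x : point) xi x = 1.

Definition ubar (S d : nat) (x : point) : R :=
  if inXd S d x then (#|[pred y : point | inXd S d y]|%:R)^-1 else 0.

Definition lam3 (S d : nat) : R :=
  let S' : R := S%:R in let d' : R := d%:R in let v' : R := v%:R in
  3 * S' ^+ 2 + 3 * S' ^+ 2 * v' ^+ 2 - 6 * S' ^+ 2 * v' - 3 * S' * d' * v' ^+ 2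
  + 3 * S' * d' * v' - 6 * S' * v' ^+ 2 + 15 * S' * v' - 9 * S'
  + d' ^+ 2 * v' ^+ 2 + 3 * d' * v' ^+ 2 - 6 * d' * v' + 2 * v' ^+ 2 - 6 * v' + 6.

Definition h3 (S d : nat) : R :=
  d%:R * lam3 S d / (4 * v%:R ^+ 2 * K%:R * (K%:R - 1) * (K%:R - 2)).

End PairedComparison.

(* Main.v *)
(* The Schur complement is dominated by the block M33(xi), and both are positive
   semidefinite. In the second-order block C = Id (x) G (x) G (x) G, where
   G = sum_p f_1(p) f_1(p)^T, put tr (C^-1 M33(xi)) in place of the determinant:
   by Hadamard's inequality and AM-GM, det N <= (tr (C^-1 N) / n)^n det C. The
   trace is the xi-average of the form D^T C^-1 D at the difference vector
   D = f_3(i) - f_3(j), which depends on the pair (i, j) only through its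
   comparison depth d and equals a positive multiple of h_3(d), so the maximal
   depth bounds it. The bound is attained by the uniform design of depth d*,
   whose invariance under relabelling the levels of each attribute and under
   permuting attributes makes its second-order block a multiple of C and kills
   the off-diagonal block.
   No square roots are available over a realFieldType, so C is diagonalised by
   unnormalised Helmert contrasts. *)
Require Import Defs.
From HB Require Import structures.
From mathcomp Require Import all_boot all_order all_algebra.
From mathcomp Require Import fingroup perm ring.
Set Implicit Arguments. Unset Strict Implicit. Unset Printing Implicit Defensive.
Import Order.TTheory GRing.Theory Num.Theory.
Local Open Scope ring_scope.

(** * Determinants of positive semidefinite matrices *)

Section PositiveSemidefinite.
Variable R : realFieldType.

Definition psd n (P : 'M[R]_n) : Prop :=
  P^T = P /\ forall z : 'rV_n, 0 <= (z *m P *m z^T) 0 0.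

Lemma psd_diag_ge0 n (P : 'M[R]_n) i : psd P -> 0 <= P i i.
Proof.
move=> [_ /(_ (delta_mx 0 i))].
by rewrite -rowE trmx_delta -colE !mxE.
Qed.

(** Its form at z is the form of the block matrix at (- z b^T / a, z), whose first coordinate is
    chosen to cancel the cross term. *)
Lemma psd_schur n (a : R) (b : 'rV[R]_n) (S : 'M[R]_n) :
  0 < a -> psd (block_mx (a%:M : 'M_1) b b^T S) ->
  psd (S - a^-1 *: (b^T *m b)).
Proof.
move=> a0 [sym pos]; split.
  move: sym; rewrite tr_block_mx => /eq_block_mx[_ _ _ SS].
  by rewrite linearB /= linearZ /= trmx_mul trmxK SS.
move=> z; have := pos (row_mx (- a^-1 *: (z *m b^T)) z).
rewrite mul_row_block tr_row_mx mul_row_col mul_mx_scalar.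
rewrite scalerA mulrN divff ?gt_eqF // scaleN1r addNr mul0mx add0r.
by rewrite -scalemxAl scaleNr mulmxBr -scalemxAr mulmxA [_ *m S - _]addrC.
Qed.

Lemma det_schur n (a : R) (b : 'rV[R]_n) (S : 'M[R]_n) :
  a != 0 ->
  \det (block_mx (a%:M : 'M_1) b b^T S) = a * \det (S - a^-1 *: (b^T *m b)).
Proof.
move=> a0; have -> : block_mx (a%:M : 'M_1) b b^T S =
  block_mx 1%:M 0 (a^-1 *: b^T) 1%:M *m
  block_mx (a%:M : 'M_1) b 0 (S - a^-1 *: (b^T *m b)).
  rewrite mulmx_block !mul1mx !mul0mx !addr0.
  by rewrite mul_mx_scalar scalerA divff // scale1r -scalemxAl addrC subrK.
by rewrite det_mulmx det_lblock det_ublock !det1 !mul1r det_scalar1.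
Qed.

Lemma psd_congr m n (A : 'M[R]_(m, n)) (P : 'M[R]_n) :
  psd P -> psd (A *m P *m A^T).
Proof.
move=> [sym pos]; split=> [|z]; first by rewrite !trmx_mul trmxK sym mulmxA.
by have := pos (z *m A); rewrite trmx_mul !mulmxA.
Qed.

(** Hadamard's inequality by induction on the size. A pivot P_00 > 0 splits off the determinant, and
    the Schur complement stays positive semidefinite with a diagonal that can only decrease. If P_00
    = 0, the whole first row vanishes. *)
Lemma det_psd_le_prod_diag n (P : 'M[R]_n) :
  psd P -> 0 <= \det P <= \prod_i P i i.
Proof.
elim: n P => [|n IHn] P psdP; first by rewrite det_mx00 big_ord0 ler01 lexx.
have [sym pos] := psdP.
have P00 := psd_diag_ge0 ord0 psdP.
have prod0 : 0 <= \prod_i P i i by apply: prodr_ge0 => i _; apply: psd_diag_ge0.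
case: (eqVneq (P 0 0) 0) => [P0|Pn0].
  suff -> : \det P = 0 by rewrite lexx prod0.
  rewrite (expand_det_row _ ord0) big1 // => j _.
  suff -> : P ord0 j = 0 by rewrite mul0r.
  (* otherwise the form is -1 at t e_0 + e_j, where t = - (P_jj + 1) / (2 P_0j) *)
  apply/eqP/negPn/negP => Pj0.
  have := pos ((- (P j j + 1) / P ord0 j / 2) *: delta_mx 0 ord0 + delta_mx 0 j).
  have Pj : P j ord0 = P ord0 j by rewrite -{1}sym mxE.
  rewrite linearD /= linearZ /= !trmx_delta.
  rewrite !(mulmxDl, mulmxDr) -!(scalemxAl, scalemxAr) -!rowE -!colE.
  rewrite !mxE P0 Pj mulr0 mulr0 add0r.
  rewrite (_ : _ + _ = -1) ?ltrN10 //; last by field.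
  by rewrite lerNr oppr0 ler10.
have a0 : 0 < P 0 0 by rewrite lt_def Pn0.
pose P' : 'M_(1 + n) := P.
have PE : P' = block_mx (P 0 0)%:M (ursubmx P') (ursubmx P')^T (drsubmx P').
  rewrite -{1}[P']submxK; congr block_mx.
    by rewrite [LHS]mx11_scalar; congr (_%:M); rewrite !mxE; congr (P _ _); apply: val_inj.
  by rewrite trmx_ursub sym.
have psdS := psd_schur a0 (eq_ind _ (@psd (1 + n)) psdP _ PE).
have /andP[S0 Sle] := IHn _ psdS.
have -> : \det P = P 0 0 *
    \det (drsubmx P' - (P 0 0)^-1 *: ((ursubmx P')^T *m ursubmx P')).
  by rewrite -[\det P]/(\det P') {1}PE det_schur.
rewrite big_ord_recl.
rewrite mulr_ge0 ?(ltW a0) //= ler_pM2l //; apply: (le_trans Sle).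
apply: ler_prod => i _; rewrite psd_diag_ge0 //= !mxE !rshift1 lerBlDr lerDl.
by rewrite big_ord1 !mxE mulr_ge0 ?invr_ge0 ?(ltW a0) // -expr2 sqr_ge0.
Qed.

(** Hadamard's inequality, then AM-GM for the ratios P_ii / D_i, whose mean is at most h. *)
Lemma det_psd_le_trace n (P : 'M[R]_n) (D : 'I_n -> R) (h : R) :
  psd P -> (forall i, 0 < D i) -> \sum_i P i i / D i <= n%:R * h ->
  \det P <= h ^+ n * \prod_i D i.
Proof.
move=> psdP D0 trP.
have /andP[_ /le_trans] := det_psd_le_prod_diag psdP; apply.
have -> : \prod_i P i i = (\prod_i (P i i / D i)) * \prod_i D i.
  by rewrite -big_split; apply: eq_bigr => i _ /=; rewrite divfK ?gt_eqF.
rewrite ler_pM2r; last exact: prodr_gt0.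
have E0 : {in 'I_n, forall i, 0 <= P i i / D i}.
  by move=> i _; rewrite divr_ge0 ?psd_diag_ge0 ?ltW.
(* Size 0 is split off because the mean divides by n. *)
case: n => [|n] in P D psdP D0 trP E0 *; first by rewrite big_ord0 expr0.
have [/= AGM _] := leif_AGM E0.
rewrite (le_trans AGM) // card_ord lerXn2r ?nnegrE //.
- by rewrite divr_ge0 ?ler0n // sumr_ge0.
- by rewrite -(pmulr_rge0 _ (ltr0Sn R n)) (le_trans _ trP) // sumr_ge0 // => i _; apply: E0.
- by rewrite ler_pdivrMr ?ltr0Sn // mulrC.
Qed.

(** Congruence by T multiplies every determinant by det T ^ 2, so N and M can be compared in
    coordinates where M is diagonal. *)
Lemma det_le_congr_diag n (T N M : 'M[R]_n) (D : 'I_n -> R) h :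
  0 < h -> (forall i, 0 < D i) -> psd (T *m N *m T^T) ->
  T *m M *m T^T = diag_mx (\row_i (h * D i)) ->
  \sum_i (T *m N *m T^T) i i / D i <= n%:R * h -> \det N <= \det M.
Proof.
move=> h0 D0 psdN TMT trN.
have detT (P : 'M[R]_n) : \det (T *m P *m T^T) = \det T ^+ 2 * \det P.
  by rewrite !det_mulmx det_tr expr2 mulrAC.
have detM : \det T ^+ 2 * \det M = h ^+ n * \prod_i D i.
  rewrite -detT TMT det_diag; under eq_bigr do rewrite mxE.
  by rewrite big_split prodr_const card_ord.
have hD0 : 0 < h ^+ n * \prod_i D i by rewrite mulr_gt0 ?exprn_gt0 ?prodr_gt0.
(* [T] is invertible because the diagonal matrix has positive determinant. *)
have T0 : 0 < \det T ^+ 2.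
  rewrite exprn_even_gt0 //=; apply: contraTneq hD0 => T0.
  by rewrite -detM T0 expr0n mul0r ltxx.
by rewrite -(ler_pM2l T0) detM -detT det_psd_le_trace.
Qed.

End PositiveSemidefinite.

(** * Weighted Gram matrices and their Schur complements *)

Section Gram.
Variables (R : realFieldType) (X : finType) (xi : X -> R).
Hypothesis xi_ge0 : forall x, 0 <= xi x.

Definition gram m n (u : X -> 'rV[R]_m) (w : X -> 'rV[R]_n) : 'M[R]_(m, n) :=
  \sum_x xi x *: ((u x)^T *m w x).

Lemma tr_gram m n (u : X -> 'rV[R]_m) (w : X -> 'rV[R]_n) :
  (gram u w)^T = gram w u.
Proof.
rewrite linear_sum; apply: eq_bigr => x _.
by rewrite linearZ /= trmx_mul trmxK.
Qed.

Lemma mul_gram m n p q (A : 'M[R]_(p, m)) (B : 'M[R]_(q, n))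
    (u : X -> 'rV[R]_m) (w : X -> 'rV[R]_n) :
  A *m gram u w *m B^T = gram (fun x => u x *m A^T) (fun x => w x *m B^T).
Proof.
rewrite mulmx_sumr mulmx_suml; apply: eq_bigr => x _.
by rewrite -scalemxAr -scalemxAl trmx_mul trmxK !mulmxA.
Qed.

Lemma psd_gram n (u : X -> 'rV[R]_n) : psd (gram u u).
Proof.
split=> [|z]; first exact: tr_gram.
rewrite mul_gram summxE sumr_ge0 // => x _.
by rewrite !mxE big_ord1 mxE mulr_ge0 // -expr2 sqr_ge0.
Qed.

(** If z is in the kernel of [gram u u], the sum of xi x (u x z^T)^2 vanishes, hence every term
    does, and [gram w u] kills z too. The inclusion lets a generalized inverse of [gram u u] act as
    an inverse on the rows of [gram w u]. *)
Lemma gram_submx m n (u : X -> 'rV[R]_m) (w : X -> 'rV[R]_n) :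
  (gram w u <= gram u u)%MS.
Proof.
rewrite submxE; apply/eqP/matrixP => i j.
have := mulmx_coker (gram u u); move: (cokermx _) => Z uuZ.
pose z := (col j Z)^T.
suff ux0 x : xi x *: (u x *m z^T) = 0.
  have -> : (gram w u *m Z) i j = (gram w u *m col j Z) i 0.
    by rewrite colE mulmxA -colE [RHS]mxE.
  rewrite mulmx_suml big1 ?mxE // => x _.
  by rewrite -scalemxAl -mulmxA scalemxAr -[col j Z]trmxK ux0 mulmx0.
have : (z *m gram u u *m z^T) 0 0 = 0.
  by rewrite trmxK -mulmxA colE [gram u u *m _]mulmxA uuZ mul0mx mulmx0 mxE.
rewrite mul_gram summxE => /eqP; rewrite psumr_eq0 => [/allP/(_ x)|y _]; last first.
  by rewrite !mxE big_ord1 mxE mulr_ge0 // -expr2 sqr_ge0.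
rewrite mem_index_enum => /(_ isT); rewrite !mxE big_ord1 mxE mulf_eq0.
case/orP=> [/eqP ->|]; first by rewrite scale0r.
rewrite mulf_eq0 orbb => /eqP uz0; apply/rowP => k.
by rewrite [k]ord1 mxE uz0 mulr0 mxE.
Qed.

(* With Y = gram w u *m pinvmx (gram u u), the Schur complement is the Gram
   matrix of the residuals w x - u x *m Y^T. *)
Lemma psd_gram_schur m n (u : X -> 'rV[R]_m) (w : X -> 'rV[R]_n) :
  let S := gram w w - gram w u *m pinvmx (gram u u) *m gram u w in
  psd S /\ psd (gram w w - S).
Proof.
set Y := gram w u *m pinvmx (gram u u) => S.
have YG : Y *m gram u u = gram w u by rewrite mulmxKpV // gram_submx.
have GY : gram u u *m Y^T = gram u w by rewrite -[RHS]tr_gram -YG [RHS]trmx_mul tr_gram.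
split; last by rewrite /S opprB addrC subrK -GY mulmxA mul_gram; apply: psd_gram.
suff -> : S = gram (fun x => w x - u x *m Y^T) (fun x => w x - u x *m Y^T).
  exact: psd_gram.
transitivity (gram w w - Y *m gram u w - gram w u *m Y^T
              + Y *m gram u u *m Y^T).
  by rewrite YG subrK.
move: Y {S YG GY} => Y.
rewrite mulmx_sumr mulmx_suml mulmx_sumr mulmx_suml -!sumrB -big_split /=.
apply: eq_bigr => x _.
rewrite -!scalemxAr -!scalemxAl -!scalerBr -scalerDr [(_ - _)^T]linearB /= trmx_mul trmxK.
rewrite mulmxBl !mulmxBr !mulmxA; congr (_ *: _).
by rewrite opprB addrA [in RHS]addrAC -!addrA [in X in _ = _ + X]addrCA.
Qed.

End Gram.

(** * Contrasts and relabelling of levels *)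

Section HelmertContrasts.
Variable R : realFieldType.

(* Row a is (1, ..., 1, - (a + 1), 0, ...) with a + 1 ones; levels are 0-based. *)
Definition helmert (a p : nat) : R :=
  if (p <= a)%N then 1 else if p == a.+1 then - a.+1%:R else 0.

Definition helmert_sqnorm (a : nat) : R := a.+1%:R * a.+2%:R.

Lemma helmert_sqnorm_gt0 a : 0 < helmert_sqnorm a.
Proof. by rewrite mulr_gt0 ?ltr0Sn. Qed.

Lemma helmert_sum a n : (a.+1 < n)%N -> \sum_(p < n) helmert a p = 0.
Proof.
(* Partial sums count the ones until the entry - (a + 1) cancels them all. *)
have sumE k : \sum_(p < k) helmert a p = if (k <= a.+1)%N then k%:R else 0.
  elim: k => [|k IHk]; first by rewrite big_ord0.
  rewrite big_ord_recr /= {}IHk ltnS /helmert.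
  case: (ltngtP k a.+1) => [ka|ka|->].
  - by rewrite ltnS in ka; rewrite ka -natr1.
  - by rewrite leqNgt ltnW //= addr0.
  - by rewrite ltnn subrr.
by move=> an; rewrite sumE leqNgt an.
Qed.

(** For a < b, row b is constantly 1 on the support of row a, so the products add up to the row sum
    0. *)
Lemma helmert_orth a b n : (a.+1 < n)%N -> (b.+1 < n)%N ->
  \sum_(p < n) helmert a p * helmert b p = (a == b)%:R * helmert_sqnorm a.
Proof.
have orth i j : (i < j)%N -> (i.+1 < n)%N ->
    \sum_(p < n) helmert i p * helmert j p = 0.
  move=> ij iN; rewrite -[RHS](helmert_sum iN); apply: eq_bigr => p _.
  rewrite /helmert; case: (leqP p i) => [/leq_trans->|]; rewrite ?(ltnW ij) ?mulr1 //.
  by case: eqP => [->|]; rewrite ?mul0r // ij mulr1.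
have sqrE k : \sum_(p < k) helmert a p * helmert a p =
    if (k <= a.+1)%N then k%:R else helmert_sqnorm a.
  elim: k => [|k IHk]; first by rewrite big_ord0.
  rewrite big_ord_recr /= {}IHk ltnS /helmert /helmert_sqnorm.
  case: (ltngtP k a.+1) => [ka|ka|->].
  - by rewrite ltnS in ka; rewrite ka mulr1 -natr1.
  - by rewrite leqNgt ltnW //= mulr0 addr0.
  - by rewrite ltnn -[a.+2%:R]natr1; ring.
move=> an bn; case: (ltngtP a b) => [ab|ba|<-].
- by rewrite orth // mul0r.
- by under eq_bigr do rewrite mulrC; rewrite orth // mul0r.
- by rewrite sqrE leqNgt an mul1r.
Qed.

(** The normalised rows form an orthonormal basis of the complement of the constants, so they give
    the projection I - J / (n + 1). The induction adds row n together with level n + 1, where all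
    earlier rows vanish. *)
Lemma helmert_complete n p q : (p <= n)%N -> (q <= n)%N ->
  \sum_(a < n) helmert a p * helmert a q / helmert_sqnorm a =
  (p == q)%:R - n.+1%:R^-1.
Proof.
rewrite /helmert_sqnorm; elim: n p q => [|n IHn] p q.
  by rewrite !leqn0 => /eqP-> /eqP->; rewrite big_ord0 invr1 subrr.
have n1 : n.+1%:R != 0 :> R by rewrite pnatr_eq0.
have n2 : n.+1%:R + 1 != 0 :> R by rewrite natr1 pnatr_eq0.
have top r : (r <= n)%N -> helmert r n.+1 = (if r == n then - n.+1%:R else 0).
  by move=> rn; rewrite /helmert leqNgt ltnS rn /= eqSS eq_sym; case: eqP => [->|].
have low r : (r <= n)%N -> helmert n r = 1 by rewrite /helmert => ->.
have top0 r : \sum_(a < n) helmert a n.+1 * helmert a r / (a.+1%:R * a.+2%:R) = 0.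
  by rewrite big1 // => a _; rewrite top ?(ltnW (ltn_ord a)) // ltn_eqF ?mul0r.
rewrite big_ord_recr /= -[n.+2%:R]natr1.
rewrite [(p <= _)%N]leq_eqVlt [(q <= _)%N]leq_eqVlt.
case/predU1P=> [->|]; [|rewrite ltnS => pn]; case/predU1P=> [->|].
- by rewrite top0 top // !eqxx mulr1n; move: n.+1%:R n1 n2 => x x0 x1; field; rewrite x0 x1.
- rewrite ltnS => qn; rewrite top0 top // eqxx low // gtn_eqF ?ltnS // mulr0n.
  by move: n.+1%:R n1 n2 => x x0 x1; field; rewrite x0 x1.
- under eq_bigr => a _ do rewrite [helmert a p * _]mulrC.
  rewrite top0 top // eqxx low // ltn_eqF ?ltnS // mulr0n.
  by move: n.+1%:R n1 n2 => x x0 x1; field; rewrite x0 x1.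
- rewrite ltnS => qn; rewrite IHn // !low //.
  by move: n.+1%:R n1 n2 => x x0 x1; field; rewrite x0 x1.
Qed.

End HelmertContrasts.

(** * Averages over relabellings of the levels *)

Section LevelAverages.
Variables (R : realFieldType) (v : nat).

Definition relabel (s : 'S_v) : 'S_v.+1 := lift_perm ord0 ord0 s.

Lemma relabel_eq0 s p : (relabel s p == ord0) = (p == ord0).
Proof. by rewrite -{1}(lift_perm_id ord0 ord0 s) (inj_eq perm_inj). Qed.

Definition contrast (phi : 'I_v.+1 -> R) : Prop :=
  phi ord0 = 0 /\ \sum_p phi p = 0.

(* v f_1(p)^T G^-1 f_1(q), with G = \sum_p f_1(p) f_1(p)^T *)
Definition level_kernel (p q : 'I_v.+1) : R :=
  if (p == ord0) || (q == ord0) then 0 else if p == q then v%:R - 1 else -1.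

Lemma contrast_lift phi : contrast phi -> \sum_(p < v) phi (lift ord0 p) = 0.
Proof. by case=> phi0; rewrite big_ord_recl phi0 add0r. Qed.

(** By transitivity the sum is the same for all levels p other than 0, and these equal sums add up
    to 0. *)
Lemma sum_relabel_contrast phi p :
  contrast phi -> \sum_(s : 'S_v) phi (relabel s p) = 0.
Proof.
move=> cphi; case: (unliftP ord0 p) => [p'|] ->; last first.
  by rewrite big1 // => s _; rewrite /relabel lift_perm_id; case: cphi.
pose B q := \sum_(s : 'S_v) phi (relabel s (lift ord0 q)).
have BE q : B q = B p'.
  rewrite /B (reindex_inj (mulgI (tperm q p'))) /=; apply: eq_bigr => s _.
  by rewrite /relabel !lift_perm_lift permM tpermL.
have : \sum_q B q = 0.
  rewrite exchange_big big1 //= => s _; rewrite -[RHS](contrast_lift cphi).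
  rewrite [RHS](reindex_inj (@perm_inj _ s)); apply: eq_bigr => q _.
  by rewrite /relabel lift_perm_lift.
rewrite (eq_bigr (fun=> B p')) => [|q _]; last exact: BE.
rewrite sumr_const card_ord => /eqP; rewrite mulrn_eq0 => /orP[/eqP v0|/eqP//].
by have := leq_ltn_trans (leq0n p') (ltn_ord p'); rewrite [X in (_ < X)%N]v0.
Qed.

(* The average over relabellings depends only on whether p = q, by double
   transitivity, and vanishes when summed over all levels q. *)
Lemma sum_relabel_contrast2 phi psi p q : (1 < v)%N ->
  contrast phi -> contrast psi ->
  \sum_(s : 'S_v) phi (relabel s p) * psi (relabel s q) =
  #|{: 'S_v}|%:R / (v%:R * (v%:R - 1)) * (\sum_r phi r * psi r) * level_kernel p q.
Proof.
move=> v1 cphi cpsi; rewrite /level_kernel.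
case: (unliftP ord0 p) => [p'|] ->; last first.
  rewrite eqxx mulr0 big1 // => s _.
  by rewrite /relabel lift_perm_id; case: cphi => -> _; rewrite mul0r.
case: (unliftP ord0 q) => [q'|] ->; last first.
  rewrite eqxx orbT mulr0 big1 // => s _.
  by rewrite /relabel lift_perm_id; case: cpsi => -> _; rewrite mulr0.
rewrite !(eq_sym _ ord0) !(negPf (neq_lift _ _)) /= (inj_eq lift_inj).
pose f r := phi (lift ord0 r); pose g r := psi (lift ord0 r).
pose A a b := \sum_(s : 'S_v) f (s a) * g (s b).
rewrite (eq_bigr (fun s : 'S_v => f (s p') * g (s q'))); last first.
  by move=> s _; rewrite /relabel !lift_perm_lift.
rewrite -/(A p' q') big_ord_recl; have [-> _] := cphi; rewrite mul0r add0r.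
rewrite -[X in _ / _ * X]/(\sum_r f r * g r); set fg := \sum_r _.
have Atau (t : 'S_v) a b : A (t a) (t b) = A a b.
  rewrite /A [RHS](reindex_inj (mulgI t)); apply: eq_bigr => s _.
  by rewrite !permM.
have v0 : v%:R != 0 :> R by rewrite pnatr_eq0 -lt0n ltnW.
have v10 : v%:R - 1 != 0 :> R by rewrite subr_eq0 pnatr_eq1 gtn_eqF.
have diag a : A a a = #|{: 'S_v}|%:R / v%:R * fg.
  have : \sum_b A b b = #|{: 'S_v}|%:R * fg.
    rewrite exchange_big /= mulr_natl -sumr_const; apply: eq_bigr => s _.
    by rewrite /fg [RHS](reindex_inj (@perm_inj _ s)).
  rewrite (eq_bigr (fun=> A a a)) => [|b _]; last first.
    by rewrite -(Atau (tperm a b)) tpermR.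
  rewrite sumr_const card_ord -[_ *+ v]mulr_natl => Aa.
  by rewrite [RHS]mulrAC -Aa [RHS]mulrC mulKf //.
case: eqP => [<-|/eqP pq]; first by rewrite diag; field; rewrite v0 v10.
(* In the row of [p'] the v - 1 entries off the diagonal agree and cancel the diagonal one, whence
   the factor - 1 / (v - 1). *)
have : \sum_b A p' b = 0.
  rewrite exchange_big big1 //= => s _; rewrite -mulr_sumr.
  suff -> : \sum_b g (s b) = 0 by rewrite mulr0.
  by rewrite -[RHS](contrast_lift cpsi) [RHS](reindex_inj (@perm_inj _ s)).
rewrite (bigD1 p') //= (eq_bigr (fun=> A p' q')) => [|b bp]; last first.
  by rewrite -(Atau (tperm b q')) tpermL tpermD // eq_sym.
rewrite (eq_bigl [in predC1 p']) // sumr_const cardC1 card_ord.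
rewrite -[_ *+ _]mulr_natr -subn1 natrB ?(ltnW v1) // diag.
move=> /eqP; rewrite addrC addr_eq0 => /eqP Apq.
by apply: (mulIf v10); rewrite Apq; field; rewrite v0 v10.
Qed.

End LevelAverages.

(** * Kronecker coordinates as lists of entries *)

Section Coordinates.
Variables (R : realFieldType) (K : nat) (A : eqType).

(* A Kronecker coordinate is a list of (attribute, contrast) entries; [loc]
   looks up the contrast used at an attribute. *)
Fixpoint loc (s : seq ('I_K * A)) (q : 'I_K) : option A :=
  if s is y :: s' then if q == y.1 then Some y.2 else loc s' q else None.

Lemma loc_None s q : (loc s q == None) = (q \notin unzip1 s).
Proof. by elim: s => [|y s IHs] /=; rewrite ?eqxx // inE; case: (q =P y.1). Qed.

Lemma mem_loc s y : uniq (unzip1 s) -> (y \in s) = (loc s y.1 == Some y.2).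
Proof.
elim: s => //= -[k b] s IHs /= /andP[ks us]; case: y IHs => q a /(_ us) IHs.
rewrite inE IHs xpair_eqE /=; case: (eqVneq q k) => [->|//].
have /eqP-> : loc s k == None by rewrite loc_None.
by rewrite orbF (inj_eq Some_inj) eq_sym.
Qed.

(** Turns a product over entries into one over all attributes, the form in which attributes can be
    averaged independently. *)
Lemma prod_loc (F : 'I_K -> option A -> R) s :
  uniq (unzip1 s) -> (forall q, F q None = 1) ->
  \prod_q F q (loc s q) = \prod_(y <- s) F y.1 (Some y.2).
Proof.
move=> us F1; elim: s us => [_|y s IHs /= /andP[ys us]].
  by rewrite big_nil big1 // => q _; apply: F1.
rewrite big_cons -IHs // (bigD1 y.1) //= eqxx [in RHS](bigD1 y.1) //=.
have /eqP-> : loc s y.1 == None by rewrite loc_None.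
by rewrite F1 mul1r; congr (_ * _); apply: eq_bigr => q /negPf->.
Qed.

Definition entry_lt (y z : 'I_K * A) := (y.1 < z.1)%N.

Lemma entry_lt_uniq s : sorted entry_lt s -> uniq (unzip1 s).
Proof.
move=> ss; rewrite -(map_inj_uniq val_inj); apply: (sorted_uniq ltn_trans ltnn).
by rewrite !sorted_map.
Qed.

Lemma loc_inj s s' : sorted entry_lt s -> sorted entry_lt s' ->
  loc s =1 loc s' -> s = s'.
Proof.
move=> ss ss' ll; apply: (@irr_sorted_eq _ entry_lt) => //.
- by move=> x y z; apply: ltn_trans.
- by move=> x; apply: ltnn.
- by move=> y; rewrite !mem_loc ?entry_lt_uniq // ll.
Qed.

End Coordinates.

(** * Moments under independent relabelling of each attribute *)

Section Relabelling.
Variables (R : realFieldType) (v K : nat).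
Implicit Types (w : point v K -> R) (i : attr v K) (x : point v K).

Definition act (s : {ffun 'I_K -> 'S_v}) i : attr v K :=
  [ffun k => relabel (s k) (i k)].

Definition act2 s x : point v K := (act s x.1, act s x.2).

Lemma act_inj s : injective (act s).
Proof.
move=> i j /ffunP ij; apply/ffunP => k.
by have := ij k; rewrite !ffunE => /perm_inj.
Qed.

Lemma act2_inj s : injective (act2 s).
Proof. by move=> [i j] [i' j'] [/act_inj-> /act_inj->]. Qed.

(** Lets the four moments in a product of two differences share one statement. *)
Definition proj (b : bool) x : attr v K := if b then x.1 else x.2.

Definition tens (phi : 'I_K -> 'I_v.+1 -> R) i := \prod_k phi k (i k).

(** Invariance allows averaging over all families of relabellings; as these are chosen independently
    per attribute, the sum of products becomes a product of sums. *)
Lemma sum_relabel_tens w phi psi b b' : (forall s x, w (act2 s x) = w x) ->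
  (\sum_x w x * tens phi (proj b x) * tens psi (proj b' x))
     *+ #|{ffun 'I_K -> 'S_v}| =
  \sum_x w x * \prod_k \sum_(s : 'S_v)
    phi k (relabel s (proj b x k)) * psi k (relabel s (proj b' x k)).
Proof.
move=> winv; rewrite -sumr_const.
under [RHS]eq_bigr do rewrite bigA_distr_bigA mulr_sumr.
rewrite [RHS]exchange_big /=; apply: eq_bigr => s _.
rewrite (reindex_inj (@act2_inj s)) /=; apply: eq_bigr => x _.
rewrite winv -mulrA; congr (_ * _); rewrite -big_split /=.
by apply: eq_bigr => k _; case: b b' => [] []; rewrite /= !ffunE.
Qed.

Lemma cross_moment_eq0 w phi psi : (forall s x, w (act2 s x) = w x) ->
  (exists k, forall p q, \sum_(s : 'S_v)
    phi k (relabel s p) * psi k (relabel s q) = 0) ->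
  \sum_x w x * (tens phi x.1 - tens phi x.2) * (tens psi x.1 - tens psi x.2) = 0.
Proof.
move=> winv [k phipsi].
pose m b b' := \sum_x w x * tens phi (proj b x) * tens psi (proj b' x).
have m0 b b' : m b b' = 0.
  have := sum_relabel_tens phi psi b b' winv.
  rewrite [in RHS]big1 => [|x _]; last by rewrite (bigD1 k) //= phipsi mul0r mulr0.
  move/eqP; rewrite mulrn_eq0 => /orP[|/eqP //].
  by rewrite -leqn0 leqNgt (cardD1 [ffun=> 1%g]).
transitivity (m true true - m true false - m false true + m false false).
  rewrite /m -!sumrB -big_split; apply: eq_bigr => x _ /=; ring.
by rewrite !m0 !subr0 addr0.
Qed.

End Relabelling.

(** * The contrasts of [f1c] and the Helmert contrasts *)

Section Contrasts.
Variables (R : realFieldType) (v : nat).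
Hypothesis v_gt1 : (1 < v)%N.

Lemma f1c_contrast a : contrast (@f1c R v ^~ a).
Proof.
split=> //; have av : (a.+1 < v)%N by rewrite -ltn_predRL.
have av1 : (a.+1 < v.+1)%N by apply: ltnW.
rewrite (bigD1 (Ordinal av1)) //= (bigD1 ord_max) /=; last first.
  by rewrite -val_eqE /= gtn_eqF.
rewrite big1 => [|p /andP[pa pv]].
  by rewrite /f1c /= ltn_eqF // eqxx gtn_eqF ?(ltnW v_gt1) // eqxx addr0 subrr.
rewrite /f1c; case: eqP => // _; rewrite -val_eqE /= in pv; rewrite (negPf pv).
by rewrite -val_eqE /= eq_sym in pa; rewrite (negPf pa).
Qed.

(* Level p is column p.-1 of the Helmert matrix; 0 is the absent level. *)
Definition level_helmert (a : 'I_v.-1) (p : 'I_v.+1) : R :=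
  if p == ord0 then 0 else helmert R a p.-1.

Lemma level_helmert_contrast a : contrast (level_helmert a).
Proof.
split; first by rewrite /level_helmert eqxx.
rewrite big_ord_recl /level_helmert eqxx add0r.
by rewrite -[RHS](@helmert_sum R a v) // -ltn_predRL.
Qed.

Lemma level_helmert_orth a b :
  \sum_p level_helmert a p * level_helmert b p = (a == b)%:R * helmert_sqnorm R a.
Proof.
rewrite big_ord_recl /level_helmert eqxx mul0r add0r.
by rewrite -(@helmert_orth R a b v) // -ltn_predRL.
Qed.

(** Both sides are f_1(p)^T G^-1 f_1(q): the v - 1 Helmert contrasts diagonalise G. *)
Lemma level_helmert_complete p q :
  \sum_a level_helmert a p * level_helmert a q / helmert_sqnorm R a =
  level_kernel R p q / v%:R.
Proof.
rewrite /level_kernel /level_helmert.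
case: (unliftP ord0 p) => [p'|] ->; last first.
  by rewrite eqxx mul0r big1 // => a _; rewrite !mul0r.
case: (unliftP ord0 q) => [q'|] ->; last first.
  by rewrite eqxx orbT mul0r big1 // => a _; rewrite mulr0 mul0r.
rewrite !(eq_sym _ ord0) !(negPf (neq_lift _ _)) /= !(inj_eq lift_inj).
have v0 : v%:R != 0 :> R by rewrite pnatr_eq0 -lt0n ltnW.
have le (r : 'I_v) : (r <= v.-1)%N by rewrite -ltnS prednK ?(ltnW v_gt1).
rewrite (helmert_complete _ (le p') (le q')) prednK ?(ltnW v_gt1) //.
rewrite -val_eqE; case: eqP => _; rewrite ?mulr1n ?mulr0n.
  by rewrite mulrBl divff // mul1r.
by rewrite sub0r mulN1r.
Qed.

(** At a level 0 < p < v, [f1c] selects one coefficient. At level v it gives minus the sum of the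
    first v - 1 Helmert entries, which is the last entry since the row sums to 0. *)
Lemma level_helmert_f1c a p :
  level_helmert a p = \sum_(c : 'I_v.-1) helmert R a c * @f1c R v p c.
Proof.
rewrite /level_helmert -val_eqE /f1c /=; case: eqP => p0.
  by rewrite big1 // => c _; rewrite mulr0.
case: eqP => pv.
  rewrite -mulr_suml mulrN1.
  have av : (a.+1 < v.-1.+1)%N by rewrite ltnS.
  have := helmert_sum R av; rewrite big_ord_recr /= pv.
  by move/eqP; rewrite addrC addr_eq0 => /eqP.
have pv1 : (p.-1 < v.-1)%N.
  have := ltn_ord p; rewrite ltnS leq_eqVlt => /predU1P[//|].
  by case: (nat_of_ord p) p0 => // n _ /=; rewrite ltn_predRL.
rewrite (bigD1 (Ordinal pv1)) //= prednK ?lt0n; last exact/eqP.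
rewrite eqxx mulr1 big1 ?addr0 // => c cp.
rewrite (_ : _ == _ = false) ?mulr0 //; apply: contraNF cp => /eqP pc.
by rewrite -val_eqE /= -pc.
Qed.

End Contrasts.

(** * Moments of invariant designs *)

Section KroneckerMoments.
Variables (R : realFieldType) (v K : nat).
Hypothesis v_gt1 : (1 < v)%N.
Implicit Types (w : point v K -> R) (i : attr v K) (x : point v K).
Implicit Types (g h : 'I_v.-1 -> 'I_v.+1 -> R) (s : seq ('I_K * 'I_v.-1)).

Definition kron g s i : R := \prod_(y <- s) g y.2 (i y.1).

Definition factor g s (k : 'I_K) (p : 'I_v.+1) : R :=
  if loc s k is Some a then g a p else 1.

Lemma kronE g s i : uniq (unzip1 s) -> kron g s i = tens (factor g s) i.
Proof.
move=> us; rewrite /tens /factor.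
by rewrite (prod_loc (F := fun q o => if o is Some a then g a (i q) else 1)).
Qed.

(** One attribute whose average vanishes suffices: either both lists use it with orthogonal
    contrasts, or exactly one list uses it and a single contrast averages to 0. *)
Lemma cross_kron_eq0 w g h s s' : (forall r x, w (act2 r x) = w x) ->
  (forall a, contrast (g a)) -> (forall a, contrast (h a)) ->
  uniq (unzip1 s) -> uniq (unzip1 s') ->
  (exists k, match loc s k, loc s' k with
             | Some a, Some b => \sum_p g a p * h b p = 0
             | None, None => False
             | _, _ => True
             end) ->
  \sum_x w x * (kron g s x.1 - kron g s x.2) * (kron h s' x.1 - kron h s' x.2) = 0.
Proof.
move=> winv cg ch us us' [k sk].
rewrite -[RHS](cross_moment_eq0 (phi := factor g s) (psi := factor h s') winv).
  by apply: eq_bigr => x _; rewrite !kronE.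
exists k => p q; rewrite /factor.
case: (loc s k) (loc s' k) sk => [a|] [b|] //= gh.
- by rewrite sum_relabel_contrast2 // gh mulr0 mul0r.
- by under eq_bigr do rewrite mulr1; apply: sum_relabel_contrast.
- by under eq_bigr do rewrite mul1r; apply: sum_relabel_contrast.
Qed.

(** Each attribute in s averages to a multiple of the level kernel; every other attribute only
    contributes the order of S_v, which cancels. *)
Lemma kron_moment w g h s b b' : (forall r x, w (act2 r x) = w x) ->
  (forall a, contrast (g a)) -> (forall a, contrast (h a)) -> uniq (unzip1 s) ->
  \sum_x w x * kron g s (proj b x) * kron h s (proj b' x) =
  (\prod_(y <- s) ((\sum_p g y.2 p * h y.2 p) / (v%:R * (v%:R - 1)))) *
  \sum_x w x * \prod_(y <- s) level_kernel R (proj b x y.1) (proj b' x y.1).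
Proof.
move=> winv cg ch us.
have := sum_relabel_tens (factor g s) (factor h s) b b' winv.
rewrite -[_ *+ _]mulr_natr card_ffun card_ord natrX.
set N : R := #|{: 'S_v}|%:R.
have N0 : N ^+ K != 0.
  by rewrite expf_neq0 // pnatr_eq0 (cardD1 1%g).
rewrite (eq_bigr (fun x => w x * kron g s (proj b x) * kron h s (proj b' x)));
  last by move=> x _; rewrite !kronE.
move=> e; apply: (mulIf N0); rewrite {}e mulrAC mulr_sumr; apply: eq_bigr => x _.
rewrite mulrCA; congr (_ * _).
pose F (k : 'I_K) (o : option 'I_v.-1) := if o is Some a then
  (\sum_p g a p * h a p) / (v%:R * (v%:R - 1))
  * level_kernel R (proj b x k) (proj b' x k) else 1.
rewrite mulrAC -big_split /= -(prod_loc (F := F)) // mulrC.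
have -> : N ^+ K = \prod_(k < K) N by rewrite prodr_const card_ord.
rewrite -big_split /=; apply: eq_bigr => k _.
rewrite /factor /F; case: (loc s k) => [a|].
  by rewrite sum_relabel_contrast2 //; rewrite -/N; ring.
by under eq_bigr do rewrite mulr1; rewrite sumr_const mulr1.
Qed.

Definition triple_kernel (k l m : 'I_K) i j : R :=
  level_kernel R (i k) (j k) * level_kernel R (i l) (j l) * level_kernel R (i m) (j m).

(* The (k, l, m) part of v^3 D^T C^-1 D, for D = f_3(x.1) - f_3(x.2). *)
Definition triple_form (k l m : 'I_K) x : R :=
  triple_kernel k l m x.1 x.1 - 2 * triple_kernel k l m x.1 x.2
  + triple_kernel k l m x.2 x.2.

(** Divided by the squared norms of its contrasts, the moment depends on the attributes k, l, m
    alone. *)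
Lemma kron3_sqr_moment w g (k l m : 'I_K) a b c : (forall r x, w (act2 r x) = w x) ->
  (forall a, contrast (g a)) ->
  let s := [:: (k, a); (l, b); (m, c)] in uniq (unzip1 s) ->
  \sum_x w x * (kron g s x.1 - kron g s x.2) ^+ 2 =
  (\sum_p g a p ^+ 2) * (\sum_p g b p ^+ 2) * (\sum_p g c p ^+ 2)
   / (v%:R * (v%:R - 1)) ^+ 3 * \sum_x w x * triple_form k l m x.
Proof.
move=> winv cg s us.
pose M d d' := \sum_x w x * kron g s (proj d x) * kron g s (proj d' x).
transitivity (M true true - 2 * M true false + M false false).
  rewrite /M mulr_sumr -sumrB -big_split; apply: eq_bigr => x _ /=; ring.
rewrite /M !kron_moment // mulrCA -mulrBr -mulrDr; congr (_ * _).
  have sqE d : \sum_p g d p * g d p = \sum_p g d p ^+ 2 by apply: eq_bigr.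
  by rewrite !big_cons big_nil /= !sqE -exprVn; move: _^-1 => d; ring.
rewrite mulr_sumr -sumrB -big_split; apply: eq_bigr => x _ /=.
by rewrite !big_cons !big_nil /triple_form /triple_kernel /=; ring.
Qed.

Definition permute (r : 'S_K) i : attr v K := [ffun k => i (r k)].

Definition permute2 r x : point v K := (permute r x.1, permute r x.2).

Lemma permute_inj r : injective (permute r).
Proof.
move=> i j /ffunP ij; apply/ffunP => k.
by have := ij (r^-1%g k); rewrite !ffunE permKV.
Qed.

Lemma permute2_inj r : injective (permute2 r).
Proof. by move=> [i j] [i' j'] [/permute_inj-> /permute_inj->]. Qed.

(** Three transpositions applied in turn, each placing one more attribute without moving those
    already placed. *)
Lemma perm_triple (k l m k' l' m' : 'I_K) :
  uniq [:: k; l; m] -> uniq [:: k'; l'; m'] ->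
  exists r : 'S_K, [/\ r k = k', r l = l' & r m = m'].
Proof.
rewrite /= !inE !negb_or !andbT => /andP[/andP[kl km] lm] /andP[/andP[kl' km'] lm'].
pose r1 := tperm k k'; pose r2 := tperm (r1 l) l'.
pose r3 := tperm (r2 (r1 m)) m'.
exists (r1 * r2 * r3)%g; rewrite !permM.
have r1k : r1 k = k' by rewrite tpermL.
have r1lk : r1 l != k' by rewrite -r1k (inj_eq perm_inj) eq_sym.
have r2k : r2 k' = k' by rewrite tpermD // eq_sym.
have r2l : r2 (r1 l) = l' by rewrite tpermL.
have r2mk : r2 (r1 m) != k' by rewrite -r2k -r1k !(inj_eq perm_inj) eq_sym.
have r2ml : r2 (r1 m) != l' by rewrite -r2l !(inj_eq perm_inj) eq_sym.
by split; rewrite ?r1k ?r2k ?r2l ?tpermL // tpermD // eq_sym.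
Qed.

Lemma sum_triple_form w k l m k' l' m' : (forall r x, w (permute2 r x) = w x) ->
  uniq [:: k; l; m] -> uniq [:: k'; l'; m'] ->
  \sum_x w x * triple_form k l m x = \sum_x w x * triple_form k' l' m' x.
Proof.
move=> winv u u'; have [r [rk rl rm]] := perm_triple u u'.
rewrite [RHS](reindex_inj (@permute2_inj r^-1%g)); apply: eq_bigr => x _.
rewrite winv /triple_form /triple_kernel /= !ffunE.
by rewrite -rk -rl -rm !permK.
Qed.

End KroneckerMoments.

(** * Elementary symmetric functions and sums over increasing triples *)

Section TripleSums.
Variables (R : realFieldType).

Lemma newton_e2 (c : nat -> R) n :
  2 * \sum_(l < n) c l * \sum_(k < l) c k =
  (\sum_(k < n) c k) ^+ 2 - \sum_(k < n) c k ^+ 2.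
Proof.
elim: n => [|n IHn]; first by rewrite !big_ord0; ring.
by rewrite !big_ord_recr /= mulrDr IHn; ring.
Qed.

(** Newton's identity for 6 e_3 in power sums. The variable c n adds c n times e_2 of the earlier
    ones to e_3, which [newton_e2] rewrites. *)
Lemma newton_e3 (c : nat -> R) n :
  6 * \sum_(m < n) c m * \sum_(l < m) c l * \sum_(k < l) c k =
  (\sum_(k < n) c k) ^+ 3 - 3 * (\sum_(k < n) c k) * \sum_(k < n) c k ^+ 2
  + 2 * \sum_(k < n) c k ^+ 3.
Proof.
elim: n => [|n IHn]; first by rewrite !big_ord0; ring.
rewrite !big_ord_recr /= mulrDr IHn.
have -> : 6 * (c n * \sum_(l < n) c l * \sum_(k < l) c k) =
    3 * c n * (2 * \sum_(l < n) c l * \sum_(k < l) c k) by ring.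
by rewrite newton_e2; ring.
Qed.

Lemma sum_ltn_triples K (c : 'I_K -> R) :
  6 * \sum_(u : 'I_K * 'I_K * 'I_K | (u.1.1 < u.1.2)%N && (u.1.2 < u.2)%N)
        c u.1.1 * c u.1.2 * c u.2 =
  (\sum_k c k) ^+ 3 - 3 * (\sum_k c k) * \sum_k c k ^+ 2 + 2 * \sum_k c k ^+ 3.
Proof.
(* Extending c by 0 to all of [nat] makes the nested sums of [newton_e3] applicable. *)
pose c' (n : nat) := if insub n is Some k then c k else 0.
have c'E (k : 'I_K) : c' k = c k by rewrite /c' valK.
have pow r : \sum_k c k ^+ r = \sum_(k < K) c' k ^+ r.
  by apply: eq_bigr => k _; rewrite c'E.
have -> : \sum_k c k = \sum_(k < K) c' k by apply: eq_bigr => k _; rewrite c'E.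
rewrite !pow -newton_e3; congr (_ * _).
have widen (m : 'I_K) (G : nat -> R) :
    \sum_(l < m) G l = \sum_(l < K) if (l < m)%N then G l else 0.
  by rewrite (big_ord_widen _ G (ltnW (ltn_ord m))) big_mkcond.
rewrite big_mkcond -(pair_bigA _ (fun (kl : 'I_K * 'I_K) (m : 'I_K) =>
  if (kl.1 < kl.2)%N && (kl.2 < m)%N
  then c kl.1 * c kl.2 * c m else 0)) /= exchange_big /=.
apply: eq_bigr => m _.
rewrite (widen m (fun l => c' l * \sum_(k < l) c' k)) mulr_sumr.
rewrite -(pair_bigA _ (fun k l : 'I_K => if (k < l)%N && (l < m)%N
  then c k * c l * c m else 0)) /= exchange_big /=.
apply: eq_bigr => l _; rewrite (widen l c'); case: ifP => [lm|_]; last first.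
  by rewrite mulr0 big1 // => k _; rewrite andbF.
rewrite !mulr_sumr; apply: eq_bigr => k _; rewrite andbT !c'E.
by case: ifP => _; [ring | rewrite !mulr0].
Qed.

Lemma sum_triple_mul (A B C : finType) (F : A -> R) (G : B -> R) (H : C -> R) :
  \sum_(u : A * B * C) F u.1.1 * G u.1.2 * H u.2 =
  (\sum_a F a) * (\sum_b G b) * \sum_c H c.
Proof.
rewrite -(pair_bigA _ (fun ab c => F ab.1 * G ab.2 * H c)) /=.
rewrite -(pair_bigA _ (fun a b => \sum_c F a * G b * H c)) /=.
rewrite big_distrlr /= mulr_suml; apply: eq_bigr => a _.
rewrite mulr_suml; apply: eq_bigr => b _.
by rewrite mulr_sumr.
Qed.

End TripleSums.

(** * Comparison depth and the uniform designs *)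

Section Designs.
Variables (R : realFieldType) (v K : nat).
Hypothesis v_gt1 : (1 < v)%N.
Implicit Types (x : point v K).

(** Of the S present attributes, d differ and have kernel -1, the others v - 1. The exponent is
    positive so that absent attributes contribute 0. *)
Lemma sum_level_kernel S d x r : inXd S d x ->
  [/\ \sum_k level_kernel R (x.1 k) (x.2 k) ^+ r.+1
        = (S%:R - d%:R) * (v%:R - 1) ^+ r.+1 + d%:R * (-1) ^+ r.+1,
      \sum_k level_kernel R (x.1 k) (x.1 k) ^+ r.+1 = S%:R * (v%:R - 1) ^+ r.+1 &
      \sum_k level_kernel R (x.2 k) (x.2 k) ^+ r.+1 = S%:R * (v%:R - 1) ^+ r.+1].
Proof.
case/andP=> /existsP[A /andP[/eqP cA /forallP Ax]].
set D := [set k | _] => /eqP cD.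
have DA : D \subset A.
  apply/subsetP => k; rewrite inE; apply: contraR => kA.
  by have := Ax k; rewrite (negPf kA) => /andP[/eqP-> /eqP->].
have out k : k \notin A -> (x.1 k = ord0) * (x.2 k = ord0).
  by move=> kA; have := Ax k; rewrite (negPf kA) => /andP[/eqP-> /eqP->].
have inA k : k \in A -> ((x.1 k == ord0) = false) * ((x.2 k == ord0) = false).
  by move=> kA; have := Ax k; rewrite kA => /andP[/negPf-> /negPf->].
split.
- rewrite (bigID [in A]) /= [X in _ + X]big1 => [|k /out[-> ->]]; last first.
    by rewrite /level_kernel eqxx expr0n.
  rewrite addr0 (big_setID D) /= (setIidPr DA) addrC.
  rewrite (eq_bigr (fun=> (v%:R - 1) ^+ r.+1)) => [|k]; last first.
    rewrite !inE negbK => /andP[/eqP e kA]; rewrite /level_kernel !inA //=.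
    by rewrite e eqxx.
  rewrite [X in _ + X](eq_bigr (fun=> (-1) ^+ r.+1)) => [|k kD]; last first.
    have kA := subsetP DA k kD; rewrite inE in kD.
    by rewrite /level_kernel !inA //= (negPf kD).
  rewrite !sumr_const cardsD (setIidPr DA) cA cD.
  rewrite -[_ *+ (S - d)]mulr_natl -[_ *+ d]mulr_natl natrB //.
  by rewrite -cA -cD subset_leq_card.
- rewrite (bigID [in A]) /= [X in _ + X]big1 => [|k /out[-> _]]; last first.
    by rewrite /level_kernel eqxx expr0n.
  rewrite addr0 (eq_bigr (fun=> (v%:R - 1) ^+ r.+1)) => [|k kA]; last first.
    by rewrite /level_kernel !inA //= eqxx.
  by rewrite sumr_const cA mulr_natl.
- rewrite (bigID [in A]) /= [X in _ + X]big1 => [|k /out[_ ->]]; last first.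
    by rewrite /level_kernel eqxx expr0n.
  rewrite addr0 (eq_bigr (fun=> (v%:R - 1) ^+ r.+1)) => [|k kA]; last first.
    by rewrite /level_kernel !inA //= eqxx.
  by rewrite sumr_const cA mulr_natl.
Qed.

(** Each kernel sums to the third elementary symmetric function of its level kernels, hence to a
    polynomial in three power sums that only involve v, S and d. *)
Lemma sum_triple_form_depth S d x : inXd S d x ->
  \sum_(u : 'I_K * 'I_K * 'I_K | (u.1.1 < u.1.2)%N && (u.1.2 < u.2)%N)
    triple_form R u.1.1 u.1.2 u.2 x = d%:R * lam3 R v S d * v%:R / 3.
Proof.
move=> xd; have [a1 b1 c1] := sum_level_kernel 0 xd.
have [a2 b2 c2] := sum_level_kernel 1 xd; have [a3 b3 c3] := sum_level_kernel 2 xd.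
have six0 : 6 != 0 :> R by rewrite pnatr_eq0.
apply: (mulfI six0); rewrite /triple_form big_split /= sumrB -mulr_sumr.
rewrite mulrDr mulrBr mulrCA.
rewrite /triple_kernel.
rewrite (sum_ltn_triples (fun k => level_kernel R (x.1 k) (x.2 k))).
rewrite (sum_ltn_triples (fun k => level_kernel R (x.1 k) (x.1 k))).
rewrite (sum_ltn_triples (fun k => level_kernel R (x.2 k) (x.2 k))).
have E1 (F : 'I_K -> R) : \sum_k F k = \sum_k F k ^+ 1 by apply: eq_bigr.
rewrite [\sum_k level_kernel R (x.1 k) (x.1 k)]E1 [\sum_k level_kernel R (x.1 k) (x.2 k)]E1.
rewrite [\sum_k level_kernel R (x.2 k) (x.2 k)]E1.
rewrite a1 a2 a3 b1 b2 b3 c1 c2 c3 /lam3.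
by field.
Qed.

Lemma inXd_act2 S d s x : inXd S d (act2 s x) = inXd S d x.
Proof.
congr (_ && (_ == d)).
  apply: eq_existsb => A; congr (_ && _); apply: eq_forallb => k.
  by rewrite /= !ffunE !relabel_eq0.
by apply: eq_card => k; rewrite !inE /= !ffunE (inj_eq perm_inj).
Qed.

Lemma inX_permute2 S r x : inX S x -> inX S (permute2 r x).
Proof.
case/existsP=> A /andP[cA /forallP Ax]; apply/existsP; exists (r @^-1: A).
rewrite card_preimset ?cA /=; last exact: perm_inj.
by apply/forallP => k; have := Ax (r k); rewrite inE !ffunE.
Qed.

Lemma permute2K r : cancel (permute2 r) (@permute2 v K r^-1%g).
Proof.
by case=> i j; congr (_, _); apply/ffunP => k; rewrite !ffunE permKV.
Qed.

Lemma inXd_permute2 S d r x : inXd S d (permute2 r x) = inXd S d x.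
Proof.
congr (_ && (_ == d)).
  apply/idP/idP; last exact: inX_permute2.
  by move/(inX_permute2 r^-1%g); rewrite permute2K.
rewrite -(card_preimset [set k | x.1 k != x.2 k] (@perm_inj _ r)).
by apply: eq_card => k; rewrite !inE /= !ffunE.
Qed.

Lemma ubar_act2 S d s x : ubar R S d (act2 s x) = ubar R S d x.
Proof. by rewrite /ubar inXd_act2. Qed.

Lemma ubar_permute2 S d r x : ubar R S d (permute2 r x) = ubar R S d x.
Proof. by rewrite /ubar inXd_permute2. Qed.

Lemma inXd_exists S d : (S <= K)%N -> (d <= S)%N -> exists x, inXd S d x.
Proof.
move=> SK dS; have l1 : (1 < v.+1)%N by apply: ltnW.
have l2 : (2 < v.+1)%N by [].
(* The first S attributes are at level 1; in [j] the first d of them move to level 2, available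
   because v >= 2. *)
pose i : attr v K := [ffun k : 'I_K => if (k < S)%N then Ordinal l1 else ord0].
pose j : attr v K := [ffun k : 'I_K => if (k < d)%N then Ordinal l2 else i k].
have card_lt n : (n <= K)%N -> #|[set k : 'I_K | (k < n)%N]| = n.
  move=> nK; rewrite -sum1_card -[RHS]card_ord -sum1_card.
  rewrite [RHS](big_ord_widen K (fun=> 1%N) nK).
  by apply: eq_bigl => k; rewrite inE.
exists (i, j); apply/andP; split.
  apply/existsP; exists [set k : 'I_K | (k < S)%N]; rewrite card_lt // eqxx /=.
  apply/forallP => k; rewrite inE !ffunE.
  case: ifP => kS; rewrite ?kS; first by case: ifP.
  by case: ifP => // kd; rewrite (leq_trans kd dS) in kS.
rewrite -[X in _ == X]card_lt ?(leq_trans dS) //; apply/eqP; apply: eq_card => k.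
rewrite !inE /= [j k]ffunE; case: ifP => kd; last by rewrite eqxx.
by rewrite ffunE (leq_trans kd dS).
Qed.

Lemma ubar_design S d : (S <= K)%N -> (d <= S)%N -> is_design S (ubar R (K := K) (v := v) S d).
Proof.
move=> SK dS; have [x0 x0d] := inXd_exists SK dS.
split; first by move=> x; rewrite /ubar; case: ifP => // _; rewrite invr_ge0 ler0n.
split; first by move=> x; rewrite /ubar; case: ifP => [/andP[]//|]; rewrite eqxx.
rewrite /ubar -big_mkcond sumr_const -[_ *+ _]mulr_natl divff //.
by rewrite pnatr_eq0 -lt0n; apply/card_gt0P; exists x0.
Qed.

End Designs.

(** * The second-order block *)

Section SecondOrder.
Variables (R : realFieldType) (v K : nat).
Hypothesis v_gt1 : (1 < v)%N.
Implicit Types (i : attr v K) (x : point v K).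

Local Notation A := 'I_v.-1.
Local Notation I1 := ('I_K * A)%type.
Local Notation I2 := {t : ('I_K * 'I_K) * (A * A) | (t.1.1 < t.1.2)%N}.
Local Notation I12 := (I1 + I2)%type.
Local Notation I3 := {t : ('I_K * 'I_K * 'I_K) * (A * A * A)
                        | (t.1.1.1 < t.1.1.2)%N && (t.1.1.2 < t.1.2)%N}.

Definition entries12 (t : I12) : seq ('I_K * A) :=
  match t with
  | inl t => [:: t]
  | inr t => let: ((k, l), (a, b)) := val t in [:: (k, a); (l, b)]
  end.

Definition entries3 (t : I3) : seq ('I_K * A) :=
  let: ((k, l, m), (a, b, c)) := val t in [:: (k, a); (l, b); (m, c)].

Lemma sorted_entries12 t : sorted (@entry_lt K A) (entries12 t).
Proof. by case: t => [//|[[[k l] [a b]] /= kl]]; rewrite /entry_lt /= kl. Qed.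

Lemma sorted_entries3 t : sorted (@entry_lt K A) (entries3 t).
Proof.
case: t => [[[[k l] m] [[a b] c]] /= /andP[kl lm]].
by rewrite /entries3 /entry_lt /= kl lm.
Qed.

Lemma entries3_inj : injective entries3.
Proof.
case=> [[[[k l] m] [[a b] c]] p] [[[[k' l'] m'] [[a' b'] c']] p'].
by rewrite /entries3 /= => -[? ? ? ? ? ?]; subst; apply: val_inj.
Qed.

Lemma f12_kron i t : f12 R i t = kron (fun a p => f1c R p a) (entries12 t) i.
Proof.
rewrite /kron; case: t => [[k a]|[[[k l] [a b]] kl]].
  by rewrite /= /fm big_seq1.
by rewrite /= /f2 /= big_cons big_seq1.
Qed.

Lemma f3_kron i t : f3 R i t = kron (fun a p => f1c R p a) (entries3 t) i.
Proof.
case: t => [[[[k l] m] [[a b] c]] klm].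
by rewrite /kron /f3 /entries3 /= !big_cons big_nil /= mulr1 mulrA.
Qed.

(** Second-order coordinates in which C is diagonal, with entries [g3_sqnorm]. *)
Definition g3 i (t : I3) : R := kron (@level_helmert R v) (entries3 t) i.

(** Block diagonal over attribute triples, each block being the Kronecker cube of the first v - 1
    Helmert columns. *)
Definition helmert_change (t s : I3) : R :=
  let: (u, (a, b, c)) := val t in let: (u', (a', b', c')) := val s in
  (u == u')%:R * (helmert R a a' * helmert R b b' * helmert R c c').

Lemma sum_I3 (F : ('I_K * 'I_K * 'I_K) * (A * A * A) -> R) :
  \sum_(t : I3) F (val t) =
  \sum_(u : 'I_K * 'I_K * 'I_K | (u.1.1 < u.1.2)%N && (u.1.2 < u.2)%N)
     \sum_a F (u, a).
Proof.
rewrite -(big_sub (fun t : ('I_K * 'I_K * 'I_K) * (A * A * A) =>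
  (t.1.1.1 < t.1.1.2)%N && (t.1.1.2 < t.1.2)%N)).
rewrite [RHS]pair_big; apply: eq_big => [t|[] //].
by rewrite andbT.
Qed.

Lemma g3_f3 i t : g3 i t = \sum_s helmert_change t s * f3 R i s.
Proof.
case: t => [[[[k l] m] [[a b] c]] klm].
pose F (w : ('I_K * 'I_K * 'I_K) * (A * A * A)) := ((k, l, m) == w.1)%:R *
  ((helmert R a w.2.1.1 * f1c R (i w.1.1.1) w.2.1.1) *
   (helmert R b w.2.1.2 * f1c R (i w.1.1.2) w.2.1.2) *
   (helmert R c w.2.2 * f1c R (i w.1.2) w.2.2)).
rewrite (eq_bigr (fun s : I3 => F (val s))); last first.
  case=> [[[[k' l'] m'] [[a' b'] c']] klm'] _.
  by rewrite /helmert_change /f3 /F /=; ring.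
rewrite (sum_I3 F) /F.
rewrite (bigD1 (k, l, m)) //= [X in _ + X]big1 => [|u /andP[_ /negPf]]; last first.
  by rewrite eq_sym => -> ; rewrite big1 // => w _; rewrite mul0r.
rewrite addr0 eqxx; under eq_bigr do rewrite mul1r.
rewrite (sum_triple_mul (fun a' : A => helmert R a a' * f1c R (i k) a')
  (fun b' : A => helmert R b b' * f1c R (i l) b')
  (fun c' : A => helmert R c c' * f1c R (i m) c')).
rewrite -!level_helmert_f1c //.
by rewrite /g3 /kron /entries3 /= !big_cons big_nil /= mulr1 mulrA.
Qed.

Definition g3_sqnorm (t : I3) : R := \prod_(y <- entries3 t) helmert_sqnorm R y.2.

Lemma g3_sqnorm_gt0 t : 0 < g3_sqnorm t.
Proof. by apply: prodr_gt0 => y _; apply: helmert_sqnorm_gt0. Qed.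

(** This is D^T C^-1 D in the diagonalising coordinates; completeness of the contrasts turns it into
    a sum of triple forms. *)
Lemma sum_g3_sqr S d x : inXd S d x ->
  \sum_t (g3 x.1 t - g3 x.2 t) ^+ 2 / g3_sqnorm t =
  d%:R * lam3 R v S d / (3 * v%:R ^+ 2).
Proof.
move=> xd; have v0 : v%:R != 0 :> R by rewrite pnatr_eq0 -lt0n ltnW.
pose F i j (w : ('I_K * 'I_K * 'I_K) * (A * A * A)) :=
  (level_helmert R w.2.1.1 (i w.1.1.1) * level_helmert R w.2.1.1 (j w.1.1.1)
     / helmert_sqnorm R w.2.1.1) *
  (level_helmert R w.2.1.2 (i w.1.1.2) * level_helmert R w.2.1.2 (j w.1.1.2)
     / helmert_sqnorm R w.2.1.2) *
  (level_helmert R w.2.2 (i w.1.2) * level_helmert R w.2.2 (j w.1.2)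
     / helmert_sqnorm R w.2.2).
pose G w := F x.1 x.1 w - 2 * F x.1 x.2 w + F x.2 x.2 w.
rewrite (eq_bigr (fun t : I3 => G (val t))); last first.
  case=> [[[[k l] m] [[a b] c]] klm] _.
  rewrite /G /F /g3 /kron /g3_sqnorm /entries3 /= !big_cons !big_nil /= !mulr1.
  have := (helmert_sqnorm_gt0 R a, helmert_sqnorm_gt0 R b, helmert_sqnorm_gt0 R c).
  case=> -[/gt_eqF/negbT na /gt_eqF/negbT nb] /gt_eqF/negbT nc.
  by field; rewrite na nb nc.
have FE i j u : \sum_w F i j (u, w) = triple_kernel R u.1.1 u.1.2 u.2 i j / v%:R ^+ 3.
  case: u => [[k l] m].
  rewrite (sum_triple_mul
    (fun a => level_helmert R a (i k) * level_helmert R a (j k) / helmert_sqnorm R a)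
    (fun a => level_helmert R a (i l) * level_helmert R a (j l) / helmert_sqnorm R a)
    (fun a => level_helmert R a (i m) * level_helmert R a (j m) / helmert_sqnorm R a)).
  by rewrite !level_helmert_complete // /triple_kernel /=; field.
rewrite (sum_I3 G).
rewrite (eq_bigr (fun u => triple_form R u.1.1 u.1.2 u.2 x / v%:R ^+ 3)); last first.
  move=> u _; rewrite /G big_split sumrB -mulr_sumr /= !FE /triple_form; ring.
rewrite -mulr_suml (sum_triple_form_depth R xd).
by field.
Qed.

End SecondOrder.

(** * The trace bound, and its equality case for invariant designs *)

Section Information.
Variables (R : realFieldType) (v K : nat).
Hypothesis v_gt1 : (1 < v)%N.
Implicit Types (x : point v K) (xi : point v K -> R).

Local Notation A := 'I_v.-1.
Local Notation I3 := {t : ('I_K * 'I_K * 'I_K) * (A * A * A)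
                        | (t.1.1.1 < t.1.1.2)%N && (t.1.1.2 < t.1.2)%N}.
Local Notation n3 := #|{: I3}|.

Definition increment (T : finType) (F : attr v K -> T -> R) x : 'rV[R]_#|{: T}| :=
  \row_r (F x.1 (enum_val r) - F x.2 (enum_val r)).

Lemma Mblk_gram (T U : finType) (F : attr v K -> T -> R) (G : attr v K -> U -> R) xi :
  Mblk F G xi = gram xi (increment F) (increment G).
Proof.
apply/matrixP => r c; rewrite mxE summxE; apply: eq_bigr => x _.
by rewrite !mxE big_ord1 !mxE mulrA.
Qed.

Definition helmert_mx : 'M[R]_n3 :=
  \matrix_(r, s) helmert_change R (enum_val r) (enum_val s).

Lemma increment_g3 x :
  increment (@f3 R v K) x *m helmert_mx^T = increment (@g3 R v K) x.
Proof.
apply/rowP => r; rewrite !mxE !g3_f3 // -sumrB.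
rewrite [RHS](reindex (enum_val (A := {: I3}))) /=; last exact/onW_bij/enum_val_bij.
by apply: eq_bigr => s _; rewrite !mxE; ring.
Qed.

Lemma helmert_gram3 xi :
  helmert_mx *m Mblk (@f3 R v K) (@f3 R v K) xi *m helmert_mx^T =
  gram xi (increment (@g3 R v K)) (increment (@g3 R v K)).
Proof.
rewrite Mblk_gram mul_gram; apply: eq_bigr => x _.
by rewrite increment_g3.
Qed.

Lemma helmert_info3_psd xi (r : 'I_n3) : (forall x, 0 <= xi x) ->
  let P := helmert_mx *m info3 xi *m helmert_mx^T in
  psd P /\ P r r <= \sum_x xi x * (g3 R x.1 (enum_val r) - g3 R x.2 (enum_val r)) ^+ 2.
Proof.
move=> xi0; rewrite /info3 !Mblk_gram.
have [psdS psdB] := psd_gram_schur xi0 (increment (@f12 R v K)) (increment (@f3 R v K)).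
split; first exact: psd_congr.
have := psd_diag_ge0 r (psd_congr helmert_mx psdB).
rewrite mulmxBr mulmxBl mxE [X in _ + X]mxE subr_ge0 => /le_trans; apply.
rewrite -Mblk_gram helmert_gram3 summxE; apply: ler_sum => x _.
by rewrite !mxE big_ord1 !mxE expr2.
Qed.

Lemma trace_helmert_info3 S c xi : is_design S xi ->
  (forall d, (d <= S)%N -> d%:R * lam3 R v S d / (3 * v%:R ^+ 2) <= c) ->
  \sum_r (helmert_mx *m info3 xi *m helmert_mx^T) r r / g3_sqnorm R (enum_val r) <= c.
Proof.
move=> [xi0 [xiX xi1]] cmax.
pose Q x := \sum_t (g3 R x.1 t - g3 R x.2 t) ^+ 2 / g3_sqnorm R t.
apply: (@le_trans _ _ (\sum_x xi x * Q x)).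
  rewrite /Q; under [leRHS]eq_bigr do rewrite mulr_sumr.
  rewrite exchange_big /= [leRHS](reindex (enum_val (A := {: I3}))) /=; last first.
    exact/onW_bij/enum_val_bij.
  apply: ler_sum => r _; have [_ Pr] := helmert_info3_psd r xi0.
  rewrite ler_pdivrMr ?g3_sqnorm_gt0 // mulr_suml (le_trans Pr) //.
  apply: ler_sum => x _; rewrite -mulrA divfK //.
  by rewrite gt_eqF ?g3_sqnorm_gt0.
rewrite -[c]mul1r -xi1 mulr_suml; apply: ler_sum => x _.
case: (eqVneq (xi x) 0) => [->|/xiX xX]; first by rewrite !mul0r.
apply: ler_wpM2l => //.
(* Each pair of the region is evaluated at its own depth, which is at most S because only present
   attributes can differ. *)
have xd : inXd S #|[set k | x.1 k != x.2 k]| x by rewrite /inXd xX eqxx.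
rewrite /Q (sum_g3_sqr R v_gt1 xd); apply: cmax.
case/existsP: xX => B /andP[/eqP<- /forallP Bx]; apply: subset_leq_card.
apply/subsetP => k; rewrite inE; apply: contraR => kB.
by have := Bx k; rewrite (negPf kB) => /andP[/eqP-> /eqP->].
Qed.

Section InvariantDesign.
Variable w : point v K -> R.
Hypothesis w_act : forall s x, w (act2 s x) = w x.
Hypothesis w_perm : forall r x, w (permute2 r x) = w x.

(** Three distinct attributes cannot all occur among at most two, and the contrast at a missing
    attribute averages to 0. *)
Lemma Mblk_f3_f12_eq0 : Mblk (@f3 R v K) (@f12 R v K) w = 0.
Proof.
apply/matrixP => r c; rewrite mxE [RHS]mxE.
move: (enum_val r) (enum_val c) => t u.
have ut := entry_lt_uniq (sorted_entries3 t).
have uu := entry_lt_uniq (sorted_entries12 u).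
have /hasP[k kt ku] : has [predC unzip1 (entries12 u)] (unzip1 (entries3 t)).
  rewrite has_predC; apply/negP => /allP /(uniq_leq_size ut).
  case: t {ut} => [[[[k l] m] [[a b] c']] ?]; case: u {uu} => [//|].
  by case=> [[[k' l'] [a' b']] ?].
rewrite -[RHS](cross_kron_eq0 v_gt1 w_act (f1c_contrast R v_gt1) (f1c_contrast R v_gt1) ut uu).
  by apply: eq_bigr => x _; rewrite !f3_kron !f12_kron.
exists k; have /eqP-> : loc (entries12 u) k == None by rewrite loc_None.
by have := loc_None (entries3 t) k; rewrite kt; case: (loc (entries3 t) k).
Qed.

(** Distinct coordinates disagree at some attribute, where either only one of them has a contrast or
    the two Helmert contrasts are orthogonal. *)
Lemma g3_cross_moment t u : t != u ->
  \sum_x w x * (g3 R x.1 t - g3 R x.2 t) * (g3 R x.1 u - g3 R x.2 u) = 0.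
Proof.
move=> tu; have st := sorted_entries3 t; have su := sorted_entries3 u.
have [k ktu] : exists k, loc (entries3 t) k != loc (entries3 u) k.
  apply/existsP; apply: contraR tu => /existsPn tu.
  apply/eqP/entries3_inj/(loc_inj st su) => k.
  by have := tu k; rewrite negbK => /eqP.
apply: (cross_kron_eq0 v_gt1 w_act (level_helmert_contrast R (v := v))
  (level_helmert_contrast R (v := v))); try exact: entry_lt_uniq.
exists k; case: (loc (entries3 t) k) (loc (entries3 u) k) ktu => [a|] [b|] // ab.
by rewrite level_helmert_orth (_ : a == b = false) ?mul0r //; apply: contraNF ab => /eqP->.
Qed.

(** Relabelling removes the dependence on the contrasts, and permuting attributes the dependence on
    the triple. *)
Lemma g3_sqr_moment t u :
  (\sum_x w x * (g3 R x.1 t - g3 R x.2 t) ^+ 2) / g3_sqnorm R t =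
  (\sum_x w x * (g3 R x.1 u - g3 R x.2 u) ^+ 2) / g3_sqnorm R u.
Proof.
have sqE a : \sum_p level_helmert R a p ^+ 2 = helmert_sqnorm R (a : A).
  by have := level_helmert_orth R a a; rewrite eqxx mul1r => <-; apply: eq_bigr.
have sqn0 (a : A) : helmert_sqnorm R a != 0 by rewrite gt_eqF ?helmert_sqnorm_gt0.
have mom s : exists k l m, uniq [:: k; l; m] /\
  (\sum_x w x * (g3 R x.1 s - g3 R x.2 s) ^+ 2) / g3_sqnorm R s =
  (\sum_x w x * triple_form R k l m x) / (v%:R * (v%:R - 1)) ^+ 3.
  have us := entry_lt_uniq (sorted_entries3 s).
  rewrite /g3 /g3_sqnorm; case: s us => [[[[k l] m] [[a b] c]] ?] us.
  exists k, l, m; split=> //.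
  rewrite (kron3_sqr_moment v_gt1 w_act (level_helmert_contrast R (v := v)) us).
  rewrite !sqE !big_cons big_nil /= mulr1; set z := (_ * _) ^+ 3.
  set y := \sum_x _.
  pose D := helmert_sqnorm R a * helmert_sqnorm R b * helmert_sqnorm R c.
  rewrite -/D (mulrA (helmert_sqnorm R a)) -/D; have D0 : D != 0.
    by apply: mulf_neq0 (sqn0 c); apply: mulf_neq0 (sqn0 a) (sqn0 b).
  by rewrite -[D / z * y]mulrA [D * _]mulrC mulfK // mulrC.
have [k [l [m [uk ->]]]] := mom t; have [k' [l' [m' [uk' ->]]]] := mom u.
by rewrite (sum_triple_form w_perm uk uk').
Qed.

Lemma helmert_info3_invariant c :
  \sum_x w x * \sum_t (g3 R x.1 t - g3 R x.2 t) ^+ 2 / g3_sqnorm R t = n3%:R * c ->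
  helmert_mx *m info3 w *m helmert_mx^T =
  diag_mx (\row_r (c * g3_sqnorm R (enum_val r))).
Proof.
move=> wc; rewrite /info3 Mblk_f3_f12_eq0 !mul0mx subr0 helmert_gram3.
apply/matrixP => r s; rewrite summxE.
under eq_bigr do rewrite !mxE big_ord1 !mxE mulrA.
rewrite mxE mxE; case: (eqVneq r s) => [<-|rs]; last first.
  by rewrite mulr0n g3_cross_moment // (inj_eq enum_val_inj).
rewrite mulr1n; set t := enum_val r.
have n0 : n3%:R != 0 :> R by rewrite pnatr_eq0 -lt0n (cardD1 t).
have D0 : g3_sqnorm R t != 0 by rewrite gt_eqF ?g3_sqnorm_gt0.
rewrite (eq_bigr (fun x => w x * (g3 R x.1 t - g3 R x.2 t) ^+ 2)); last first.
  by move=> x _; rewrite expr2 mulrA.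
(* The normalised diagonal entries are all equal and their sum is [n3%:R * c], so each is c. *)
rewrite -[LHS](divfK D0); congr (_ * _); apply: (mulfI n0); rewrite -wc.
under [RHS]eq_bigr do rewrite mulr_sumr.
rewrite exchange_big /= mulr_natl -sumr_const; apply: eq_bigr => u _.
by rewrite (g3_sqr_moment t u) mulr_suml; apply: eq_bigr => x _; rewrite mulrA.
Qed.

End InvariantDesign.

End Information.

(** * Optimality of the depth maximizing [h3] *)

Lemma lam3_depth1_gt0 (R : realFieldType) v S : (1 < v)%N -> (2 < S)%N -> 0 < lam3 R v S 1.
Proof.
move=> v1 S2.
have -> : lam3 R v S 1 = 3 * (S%:R - 1) * (S%:R - 2) * (v%:R - 1) ^+ 2.
  by rewrite /lam3; ring.
rewrite !mulr_gt0 ?exprn_gt0 ?subr_gt0 ?ltr1n ?ltr_nat //.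
exact: ltnW.
Qed.

Lemma h3_leP (R : realFieldType) v K S d d' : (1 < v)%N -> (2 < K)%N ->
  (h3 R v K S d <= h3 R v K S d') =
  (d%:R * lam3 R v S d / (3 * v%:R ^+ 2) <= d'%:R * lam3 R v S d' / (3 * v%:R ^+ 2)).
Proof.
move=> v1 K2; have v0 : 0 < v%:R :> R by rewrite ltr0n ltnW.
rewrite /h3 !ler_pM2r // invr_gt0 ?mulr_gt0 ?exprn_gt0 ?subr_gt0 ?ltr1n ?ltr_nat //.
- by rewrite ltr0n (leq_trans _ K2).
- by rewrite ltnW.
Qed.

Theorem theorem1 (R : realFieldType) (v K S dstar : nat)
  (hv : (2 <= v)%N) (hK : (3 <= K)%N) (hS3 : (3 <= S)%N) (hSK : (S <= K)%N)
  (hd1 : (1 <= dstar)%N) (hdS : (dstar <= S)%N)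
  (hmax : forall d : nat, (1 <= d)%N -> (d <= S)%N -> @h3 R v K S d <= @h3 R v K S dstar) :
  @is_design R v K S (@ubar R v K S dstar) /\
  forall xi : point v K -> R, @is_design R v K S xi ->
    \det (@info3 R v K xi) <= \det (@info3 R v K (@ubar R v K S dstar)).
Proof.
have ubarD := ubar_design R hv hSK hdS.
split=> // xi xiD.
pose q d : R := d%:R * lam3 R v S d / (3 * v%:R ^+ 2).
(* Depth 1 already gives a positive value, so the maximum is positive. *)
have q0 : 0 < q dstar.
  apply: (@lt_le_trans _ _ (q 1%N)); last first.
    by rewrite -(h3_leP _ _ _ _ hv hK) hmax // (leq_trans _ hS3).
  rewrite /q mul1r divr_gt0 ?lam3_depth1_gt0 // mulr_gt0 // exprn_gt0 // ltr0n.
  exact: ltnW.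
(* Pairs with i = j have depth 0, outside the range of [hmax]; there q is 0, below the positive
   [q dstar]. *)
have qmax d : (d <= S)%N -> q d <= q dstar.
  case: d => [_|d dS]; first by rewrite {1}/q !mul0r ltW.
  by rewrite -(h3_leP _ _ _ _ hv hK) hmax.
set n := #|{: {t : ('I_K * 'I_K * 'I_K) * ('I_v.-1 * 'I_v.-1 * 'I_v.-1)
              | (t.1.1.1 < t.1.1.2)%N && (t.1.1.2 < t.1.2)%N}}|.
have n_gt0 : (0 < n)%N.
  have v1 : (0 < v.-1)%N by rewrite ltn_predRL.
  pose a := Ordinal v1; pose k0 := Ordinal (ltnW (ltnW hK) : (0 < K)%N).
  pose k1 := Ordinal (ltnW hK : (1 < K)%N); pose k2 := Ordinal (hK : (2 < K)%N).
  by apply/card_gt0P; exists (exist _ ((k0, k1, k2), (a, a, a)) isT).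
have n0 : n%:R != 0 :> R by rewrite pnatr_eq0 -lt0n.
(* The trace [q dstar] is shared equally by the n diagonal entries. *)
pose c := q dstar / n%:R.
have nc : n%:R * c = q dstar by rewrite mulrC divfK.
pose T := helmert_mx R v K.
have ubarT : T *m info3 (ubar R S dstar) *m T^T =
    diag_mx (\row_r (c * g3_sqnorm R (enum_val r))).
  apply: (helmert_info3_invariant hv (ubar_act2 R S dstar) (ubar_permute2 R S dstar)).
  rewrite nc -[RHS]mul1r; have [_ [_ <-]] := ubarD; rewrite mulr_suml.
  apply: eq_bigr => x _; rewrite /ubar; case: ifP => [xd|]; last by rewrite !mul0r.
  by rewrite (sum_g3_sqr R hv xd).
have c0 : 0 < c by rewrite divr_gt0 // ltr0n.
have [xi0 _] := xiD.
apply: (det_le_congr_diag c0 (fun r => g3_sqnorm_gt0 R (enum_val r)) _ ubarT).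
- by have [] := helmert_info3_psd (Ordinal n_gt0) xi0.
- by rewrite nc; apply: trace_helmert_info3 xiD qmax.
Qed.
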